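(* Let $M$ be a smooth manifold, $h$ a non-degenerate symmetric $(0,2)$-tensor field and $\nabla$ a torsion-free affine connection on $M$ such that $(M,h,\nabla)$ is a statistical manifold. Let $J:TM\to TM$ be an $h$-symmetric $(1,1)$-tensor field and let $$\hat J_-=\begin{pmatrix} J & -(I+J^2)h^{-1}\\ h & -J^*\end{pmatrix}$$ be the generalized almost complex structure on $TM\oplus T^*M$ induced by $(h,J)$. Then the Nijenhuis tensor field of $\hat J_-$ with respect to $[\cdot,\cdot]_{\nabla^{(\alpha)}}$ satisfies $$N_{\hat J_-}^{\nabla^{(\alpha)}}(X+\eta,Y+\beta)=N_{\hat J_-}^{\nabla}(X+\eta,Y+\beta)$$ for all vector fields $X,Y$, all $1$-forms $\eta,\beta$ and all $\alpha\in\mathbb{R}$ if and only if the tensor field $F(X,Y,Z)=h((\nabla_XJ)Y,Z)$ satisfies $$F(X,Y,Z)+F(Y,Z,X)-F(X,Z,Y)-F(Y,X,Z)=0$$ for all vector fields $X,Y,Z$ on $M$.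
   Context: The tensor $h$ is identified with the bundle isomorphism $h:TM\to T^*M$, $h(X)=h(X,\cdot)$, with inverse $h^{-1}$. $(M,h,\nabla)$ is a statistical manifold if $\nabla$ is torsion-free and $(\nabla_Xh)(Y,Z)=(\nabla_Yh)(X,Z)$ for all $X,Y,Z$. $J$ is $h$-symmetric if $h(JX,Y)=h(X,JY)$; $(J^*\eta)(X)=\eta(JX)$. The matrix means $\hat J_-(X+\eta)=JX-(I+J^2)h^{-1}(\eta)+h(X)-J^*\eta$. The dual connection $\nabla^*$ is defined by $X(h(Y,Z))=h(\nabla_XY,Z)+h(Y,\nabla^*_XZ)$, and $\nabla^{(\alpha)}=\frac{1+\alpha}{2}\nabla+\frac{1-\alpha}{2}\nabla^*$. For an affine connection $D$ on $M$ (acting on $1$-forms by $(D_X\beta)(Y)=X(\beta(Y))-\beta(D_XY)$), the bracket is $[X+\eta,Y+\beta]_D=[X,Y]+D_X\beta-D_Y\eta$, and the Nijenhuis tensor of an endomorphism $\hat J$ of $TM\oplus T^*M$ with respect to $D$ is $N_{\hat J}^{D}(\sigma,\tau)=[\hat J\sigma,\hat J\tau]_D-\hat J[\hat J\sigma,\tau]_D-\hat J[\sigma,\hat J\tau]_D+\hat J^2[\sigma,\tau]_D$. *)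

(* Defs.v *)
From HB Require Import structures.
From mathcomp Require Import all_boot all_order all_algebra ring.
From mathcomp Require Import all_classical all_reals all_analysis.
Set Implicit Arguments.
Unset Strict Implicit.
Unset Printing Implicit Defensive.
Import Order.TTheory GRing.Theory Num.Theory.
Import numFieldNormedType.Exports.
Local Open Scope classical_set_scope.
Local Open Scope ring_scope.

(* A manifold is a topological space with a smooth atlas.  Vector fields are
   the R-derivations of C^oo(M), and tensor fields are the C^oo(M)-multilinear
   maps on the module X(M) of vector fields, as in Helgason, "Differential
   Geometry, Lie Groups, and Symmetric Spaces", ch. I.  In particular 1-forms
   are the elements of the dual module of X(M), and bundle maps over M are the
   C^oo(M)-linear maps of sections. *)

Section SmoothEuclidean.
Context {R : realType} {n : nat}.
Implicit Types (U : set 'rV[R]_n) (f g : 'rV[R]_n -> R).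

(* Partial derivatives up to order k exist and are continuous at the points
   of U.  To be used for open U only. *)
Fixpoint Ck (k : nat) U f : Prop :=
  (forall x, U x -> {for x, continuous f}) /\
  match k with
  | 0%N => True
  | k'.+1 => forall i : 'I_n,
      (forall x, U x -> derivable f x (delta_mx 0 i)) /\
      Ck k' U (fun x => 'D_(delta_mx 0 i) f x)
  end.

Definition smooth_on U f := forall k, Ck k U f.

Definition smooth_map_on m U (F : 'rV[R]_n -> 'rV[R]_m) :=
  forall j, smooth_on U (fun x => F x 0 j).

Lemma open_eq_near U f g x : open U -> {in U, f =1 g} -> U x -> {near x, f =1 g}.
Proof.
move=> oU fg Ux; near=> y; apply: fg; rewrite inE; near: y.
exact: open_nbhs_nbhs.
Unshelve. all: by end_near. Qed.

Lemma Ck_ext k U f g : open U -> {in U, f =1 g} -> Ck k U f -> Ck k U g.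
Proof.
move=> oU; elim: k f g => [|k IH] f g fg [cf Cf]; (split; last first).
- by [].
- move=> x Ux; rewrite /prop_for /continuous_at -(fg x (mem_set Ux)).
  have : f @ x --> f x by exact: cf.
  exact: cvg_trans (near_eq_cvg (open_eq_near oU fg Ux)).
- move=> i; have [df Cdf] := Cf i; split.
    move=> x Ux; exact: near_eq_derivable (open_eq_near oU fg Ux) (df x Ux).
  apply: (IH _ _ _ Cdf) => x; rewrite inE => Ux.
  exact: near_eq_derive (open_eq_near oU fg Ux).
- move=> x Ux; rewrite /prop_for /continuous_at -(fg x (mem_set Ux)).
  have : f @ x --> f x by exact: cf.
  exact: cvg_trans (near_eq_cvg (open_eq_near oU fg Ux)).
Qed.

Lemma CkW k U f : Ck k.+1 U f -> Ck k U f.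
Proof.
elim: k f => [|k IH] f [cf Cf]; split=> // i.
by have [df Cdf] := Cf i; split=> //; exact: IH.
Qed.

Lemma Ck_cst k U c : Ck k U (fun=> c).
Proof.
elim: k c => [|k IH] c; split=> //.
- by move=> x _; exact: cst_continuous.
- by move=> x _; exact: cst_continuous.
- move=> i; split=> [x _|]; first exact: derivable_cst.
  have D0 : (fun x : 'rV[R]_n => 'D_(delta_mx 0 i) (fun=> c : R) x) = (fun=> 0).
    by apply/funext => x; exact: derive_cst.
  rewrite D0.
  exact: IH.
Qed.

Lemma CkD k U f g : open U -> Ck k U f -> Ck k U g -> Ck k U (f + g).
Proof.
move=> oU; elim: k f g => [|k IH] f g [cf Cf] [cg Cg]; split=> //.
- by move=> x Ux; apply: continuousD; [exact: cf|exact: cg].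
- by move=> x Ux; apply: continuousD; [exact: cf|exact: cg].
- move=> i; have [df Cdf] := Cf i; have [dg Cdg] := Cg i; split.
    by move=> x Ux; apply: derivableD; [exact: df|exact: dg].
  apply: Ck_ext oU _ (IH _ _ Cdf Cdg) => x; rewrite inE => Ux.
  by rewrite deriveD; [|exact: df|exact: dg].
Qed.

Lemma CkM k U f g : open U -> Ck k U f -> Ck k U g -> Ck k U (f * g).
Proof.
move=> oU; elim: k f g => [|k IH] f g Hf Hg.
  by case: Hf Hg => cf _ [cg _]; split=> // x Ux; apply: continuousM;
    [exact: cf|exact: cg].
have /CkW Hf' := Hf; have /CkW Hg' := Hg.
case: Hf Hg => cf Cf [cg Cg]; split.
  by move=> x Ux; apply: continuousM; [exact: cf|exact: cg].
move=> i; have [df Cdf] := Cf i; have [dg Cdg] := Cg i; split.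
  by move=> x Ux; apply: derivableM; [exact: df|exact: dg].
apply: Ck_ext oU _ (CkD oU (IH _ _ Hf' Cdg) (IH _ _ Hg' Cdf)) => x.
by rewrite inE => Ux; rewrite deriveM; [|exact: df|exact: dg].
Qed.

End SmoothEuclidean.

Record chart (R : realType) (n : nat) (M : topologicalType) := Chart {
  cdom : set M;
  cmap : M -> 'rV[R]_n;
  cinv : 'rV[R]_n -> M }.

Definition cran (R : realType) n M (c : chart R n M) : set 'rV[R]_n :=
  cmap c @` cdom c.

Definition is_chart (R : realType) n M (c : chart R n M) :=
  [/\ open (cdom c), open (cran c),
      {in cdom c, cancel (cmap c) (cinv c)},
      {within cdom c, continuous (cmap c)} &
      {within cran c, continuous (cinv c)}].

Record smoothManifold (R : realType) := SmoothManifold {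
  points :> topologicalType;
  mdim : nat;
  atlas : set (chart R mdim points);
  manifold_hausdorff : hausdorff_space points;
  manifold_second_countable : @second_countable points;
  atlas_chart : forall c, atlas c -> is_chart c;
  atlas_cover : forall p, exists2 c, atlas c & cdom c p;
  atlas_compat : forall c d, atlas c -> atlas d ->
    smooth_map_on (cmap c @` (cdom c `&` cdom d)) (cmap d \o cinv c) }.

Section Fields.
Context {R : realType} (M : smoothManifold R).

Definition smooth (f : M -> R) :=
  forall c, atlas c -> smooth_on (cran c) (f \o cinv c).

Definition smooth_pred : {pred M -> R} := fun f => `[< smooth f >].

Lemma smooth_subring : subring_closed smooth_pred.
Proof.
split.
- by apply/asboolP => c _ k; exact: Ck_cst.
- move=> f g /asboolP sf /asboolP sg; apply/asboolP => c Ac k.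
  have [_ oc _ _ _] := atlas_chart Ac.
  have := CkD oc (sf c Ac k) (CkM oc (Ck_cst k (cran c) (-1)) (sg c Ac k)).
  apply: Ck_ext => // x _.
  rewrite [LHS]/(f (cinv c x) + -1 * g (cinv c x)).
  by rewrite mulN1r.
- move=> f g /asboolP sf /asboolP sg; apply/asboolP => c Ac k.
  have [_ oc _ _ _] := atlas_chart Ac.
  exact: CkM oc (sf c Ac k) (sg c Ac k).
Qed.
HB.instance Definition _ := GRing.isSubringClosed.Build (M -> R : pzRingType)
  smooth_pred smooth_subring.

Lemma smooth_submod : submod_closed smooth_pred.
Proof.
split; first exact: rpred0.
move=> a f g sf sg; apply: rpredD => //.
have sa : (fun=> a) \in smooth_pred by apply/asboolP => c _ k; exact: Ck_cst.
exact: rpredM sa sf.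
Qed.
HB.instance Definition _ := GRing.isSubmodClosed.Build R (M -> R : lmodType R)
  smooth_pred smooth_submod.

Record smoothfun := Smoothfun {
  smoothfun_val :> M -> R;
  smoothfunP : smoothfun_val \in smooth_pred }.
HB.instance Definition _ := [isSub for smoothfun_val].
HB.instance Definition _ := [Choice of smoothfun by <:].
HB.instance Definition _ :=
  GRing.SubChoice_isSubComPzRing.Build (M -> R) smooth_pred smoothfun
    smooth_subring.
HB.instance Definition _ := [SubZmodule_isSubLmodule of smoothfun by <:].

Local Notation C := smoothfun.

Definition is_derivation (X : C -> C) :=
  (forall (a : R) f g, X (a *: f + g) = a *: X f + X g) /\
  (forall f g, X (f * g) = f * X g + X f * g).

Definition derivation_pred : {pred C -> C^o} := fun X => `[< is_derivation X >].

Lemma derivation_submod : submod_closed derivation_pred.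
Proof.
split.
  apply/asboolP; split=> [a f g|f g].
    by rewrite /GRing.zero/= scaler0 addr0.
  by rewrite /GRing.zero/= mulr0 mul0r addr0.
move=> u X Y /asboolP[X1 X2] /asboolP[Y1 Y2]; apply/asboolP.
have E f : (u *: X + Y) f = u * X f + Y f by [].
split=> [a f g|f g]; rewrite !E.
  rewrite X1 Y1 mulrDr scalerDr addrACA; congr (_ + _ + _).
  by apply: val_inj; apply/funext => p; rewrite /= /GRing.mul /GRing.scale /= mulrCA.
rewrite X2 Y2; ring.
Qed.

Record vfield := Vfield {
  vfield_val :> C -> C;
  vfieldP : (vfield_val : C -> C^o) \in derivation_pred }.
HB.instance Definition _ := [isSub for vfield_val].
HB.instance Definition _ := [Choice of vfield by <:].
HB.instance Definition _ :=
  GRing.SubChoice_isSubLmodule.Build C (C -> C^o) derivation_pred vfield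
    derivation_submod.

Definition oneform_pred : {pred vfield -> C^o} :=
  fun eta => `[< linear (eta : vfield -> C^o) >].

Lemma oneform_submod : submod_closed oneform_pred.
Proof.
split.
  by apply/asboolP => a X Y; rewrite /GRing.zero/= scaler0 addr0.
move=> u eta beta /asboolP leta /asboolP lbeta; apply/asboolP => a X Y.
have E Z : (u *: eta + beta) Z = u * eta Z + beta Z by [].
have etaP : eta (a *: X + Y) = a * eta X + eta Y := leta a X Y.
have betaP : beta (a *: X + Y) = a * beta X + beta Y := lbeta a X Y.
have scE f g : f *: (g : C^o) = f * (g : C) by [].
rewrite !E scE etaP betaP; ring.
Qed.

Record oneform := Oneform {
  oneform_val :> vfield -> C;
  oneformP : (oneform_val : vfield -> C^o) \in oneform_pred }.
HB.instance Definition _ := [isSub for oneform_val].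
HB.instance Definition _ := [Choice of oneform by <:].
HB.instance Definition _ :=
  GRing.SubChoice_isSubLmodule.Build C (vfield -> C^o) oneform_pred oneform
    oneform_submod.

(* Sections of TM (+) T^*M; (X, eta) stands for X + eta. *)
Definition gsection := (vfield * oneform)%type.

Implicit Types (X Y Z : vfield) (eta beta : oneform).

Lemma lie_subproof X Y :
  ((fun f => X (Y f) - Y (X f)) : C -> C^o) \in derivation_pred.
Proof.
have /asboolP[X1 X2] := vfieldP X; have /asboolP[Y1 Y2] := vfieldP Y.
have XD f g : X (f + g) = X f + X g by rewrite -[f in LHS]scale1r X1 scale1r.
have YD f g : Y (f + g) = Y f + Y g by rewrite -[f in LHS]scale1r Y1 scale1r.
apply/asboolP; split=> [a f g|f g].
  by rewrite !(X1, Y1) opprD addrACA scalerBr.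
rewrite X2 Y2 !(XD, YD) !(X2, Y2); ring.
Qed.
Definition lie X Y : vfield := Vfield (lie_subproof X Y).

(* Affine connections; R-linearity in the second argument follows from
   additivity and the Leibniz rule. *)
Record connection := Connection {
  conn :> vfield -> vfield -> vfield;
  conn_linearl : forall Y, linear (conn ^~ Y);
  conn_additive : forall X Y Z, conn X (Y + Z) = conn X Y + conn X Z;
  conn_leibniz : forall X (f : C) Y, conn X (f *: Y) = X f *: Y + f *: conn X Y }.

Record tensor02 := Tensor02 {
  tensor02_val :> vfield -> vfield -> C;
  tensor02_linearl : forall Y, linear (tensor02_val ^~ Y : vfield -> C^o);
  tensor02_linearr : forall X, linear (tensor02_val X : vfield -> C^o) }.

Definition tensor11 := {linear vfield -> vfield}.

End Fields.

Section Geometry.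
Context {R : realType} {M : smoothManifold R}.
Local Notation C := (smoothfun M).
Implicit Types (h : tensor02 M) (J : tensor11 M) (D Ds : connection M).
Implicit Types (X Y Z : vfield M) (eta beta : oneform M) (s t : gsection M).

Definition symmetric_tensor h := forall X Y, h X Y = h Y X.

(* Non-degeneracy of h_p on T_pM for every p: the value of X at p is the point
   derivation f |-> X f p, every tangent vector at p is the value of a global
   field, and h X Y p depends only on the values of X and Y at p. *)
Definition nondegenerate_tensor h := forall (p : M) X,
  (forall Y, h X Y p = 0) -> forall f : C, X f p = 0.

Lemma flat_subproof h X : (h X : vfield M -> C^o) \in @oneform_pred R M.
Proof. by apply/asboolP; exact: tensor02_linearr. Qed.
Definition flat h X : oneform M := Oneform (flat_subproof h X).

Lemma codual_subproof J eta :
  ((fun X => eta (J X)) : vfield M -> C^o) \in @oneform_pred R M.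
Proof.
have /asboolP le := oneformP eta.
by apply/asboolP => a X Y; rewrite linearP le.
Qed.
Definition codual J eta : oneform M := Oneform (codual_subproof J eta).

Lemma cov_oneform_subproof D X beta :
  ((fun Y => X (beta Y) - beta (D X Y)) : vfield M -> C^o)
    \in @oneform_pred R M.
Proof.
have /asboolP lb := oneformP beta; have /asboolP[X1 X2] := vfieldP X.
have XD f g : X (f + g) = X f + X g by rewrite -[f in LHS]scale1r X1 scale1r.
have bD Y Z : beta (Y + Z) = beta Y + beta Z.
  by rewrite -[Y in LHS]scale1r lb scale1r.
have b0 : beta 0 = 0 by apply: (addrI (beta 0)); rewrite -bD !addr0.
have bZ f Y : beta (f *: Y) = f * beta Y.
  by rewrite -[f *: Y]addr0 lb b0 addr0.
apply/asboolP => a Y Z; rewrite /GRing.scale/=.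
rewrite conn_additive conn_leibniz !bD !bZ XD X2; ring.
Qed.
Definition cov_oneform D X beta : oneform M :=
  Oneform (cov_oneform_subproof D X beta).

Definition cov_tensor02 D h X Y Z : C := X (h Y Z) - h (D X Y) Z - h Y (D X Z).

Definition cov_tensor11 D J X Y : vfield M := D X (J Y) - J (D X Y).

Definition torsion_free D := forall X Y, D X Y - D Y X = lie X Y.

Definition statistical h D :=
  torsion_free D /\
  forall X Y Z, cov_tensor02 D h X Y Z = cov_tensor02 D h Y X Z.

Definition dual_connection h D Ds :=
  forall X Y Z, X (h Y Z) = h (D X Y) Z + h Y (Ds X Z).

Definition h_symmetric h J := forall X Y, h (J X) Y = h X (J Y).

Definition cst_fun (a : R) : C := a *: (1 : C).

Definition alpha_conn_fun D Ds (a : R) X Y : vfield M :=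
  cst_fun ((1 + a) / 2) *: D X Y + cst_fun ((1 - a) / 2) *: Ds X Y.

Lemma alpha_conn_linearl D Ds a Y : linear (alpha_conn_fun D Ds a ^~ Y).
Proof.
move=> f X Z; rewrite /alpha_conn_fun (conn_linearl D Y) (conn_linearl Ds Y).
by rewrite !scalerDr addrACA !scalerA ![f * _]mulrC.
Qed.

Lemma alpha_conn_additive D Ds a X Y Z :
  alpha_conn_fun D Ds a X (Y + Z) =
  alpha_conn_fun D Ds a X Y + alpha_conn_fun D Ds a X Z.
Proof. by rewrite /alpha_conn_fun !conn_additive !scalerDr addrACA. Qed.

Lemma alpha_conn_leibniz D Ds a X (f : C) Y :
  alpha_conn_fun D Ds a X (f *: Y) =
  X f *: Y + f *: alpha_conn_fun D Ds a X Y.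
Proof.
rewrite /alpha_conn_fun !conn_leibniz !scalerDr addrACA !scalerA ![f * _]mulrC.
congr (_ + _); rewrite -scalerDl -mulrDl /cst_fun -scalerDl -mulrDl.
by rewrite addrACA subrr addr0 divff// scale1r mul1r.
Qed.

Definition alpha_conn D Ds (a : R) : connection M :=
  Connection (alpha_conn_linearl D Ds a) (alpha_conn_additive D Ds a)
    (alpha_conn_leibniz D Ds a).

Definition bracket D s t : gsection M :=
  (lie s.1 t.1, cov_oneform D s.1 t.2 - cov_oneform D t.1 s.2).

Definition nijenhuis D (Jh : gsection M -> gsection M) s t : gsection M :=
  bracket D (Jh s) (Jh t) - Jh (bracket D (Jh s) t) - Jh (bracket D s (Jh t))
  + Jh (Jh (bracket D s t)).

(* The matrix (J, -(I + J^2) h^-1; h, -J^* ), with hinv standing for h^-1. *)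
Definition Jhat_minus h (hinv : oneform M -> vfield M) J s : gsection M :=
  (J s.1 - (hinv s.2 + J (J (hinv s.2))), flat h s.1 - codual J s.2).

Definition F_tensor h D J X Y Z : C := h (cov_tensor11 D J X Y) Z.

End Geometry.

(* Main.v *)
Require Import Defs.
From HB Require Import structures.
From mathcomp Require Import all_boot all_order all_algebra.
From mathcomp Require Import all_classical all_reals all_analysis.
From mathcomp Require Import ring.
Set Implicit Arguments.
Unset Strict Implicit.
Unset Printing Implicit Defensive.
Import Order.TTheory GRing.Theory Num.Theory.
Import numFieldNormedType.Exports.
Local Open Scope ring_scope.

(* Put K = nabla* - nabla.  Then h(K(X,Y),Z) = (nabla_X h)(Y,Z) is totally
   symmetric, and passing from nabla to nabla^(alpha) changes the bracket of
   X + h(A) and Y + h(B) by (1 - alpha)/2 times h(K(Y,A) - K(X,B)).  Hence the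
   two Nijenhuis tensors agree for all alpha iff an expression in K and J
   vanishes; taking A = B = 0 it reads K(JX,Y) = K(X,JY), and conversely this
   identity cancels all its terms.  Differentiating h(JY,Z) = h(Y,JZ) shows
   that the cyclic expression in F equals h(K(JX,Y) - K(X,JY),Z). *)

(** * Linear algebra of [h], its inverse and the matrix over smooth functions *)

Section Forms.
Context {R : realType} {M : smoothManifold R}.
Local Notation C := (smoothfun M).
Implicit Types (f : C) (h : tensor02 M) (J : tensor11 M) (D Ds : connection M).
Implicit Types (X Y Z : vfield M) (eta beta : oneform M) (s t : gsection M).

Lemma oneform_eq eta beta : (forall X, eta X = beta X) -> eta = beta.
Proof. by move=> E; apply/val_inj/funext. Qed.

Lemma oneformZD eta f X Y : eta (f *: X + Y) = f * eta X + eta Y.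
Proof. by have /asboolP := oneformP eta; apply. Qed.

Lemma tensor02ZDl h f X Y Z : h (f *: X + Y) Z = f * h X Z + h Y Z.
Proof. exact: (tensor02_linearl h Z). Qed.

Lemma tensor02ZDr h f X Y Z : h Z (f *: X + Y) = f * h Z X + h Z Y.
Proof. exact: (tensor02_linearr h Z). Qed.

Lemma tensor02Dl h X Y Z : h (X + Y) Z = h X Z + h Y Z.
Proof. by rewrite -[X in LHS]scale1r tensor02ZDl mul1r. Qed.

Lemma tensor020l h Z : h 0 Z = 0.
Proof. by apply: (addrI (h 0 Z)); rewrite -tensor02Dl !addr0. Qed.

Lemma tensor02Nl h X Z : h (- X) Z = - h X Z.
Proof. by apply/eqP; rewrite -addr_eq0 -tensor02Dl addNr tensor020l. Qed.

Lemma tensor02Bl h X Y Z : h (X - Y) Z = h X Z - h Y Z.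
Proof. by rewrite tensor02Dl tensor02Nl. Qed.

Lemma tensor02Dr h X Y Z : h Z (X + Y) = h Z X + h Z Y.
Proof. by rewrite -[X in LHS]scale1r tensor02ZDr mul1r. Qed.

Lemma tensor02Br h X Y Z : h Z (X - Y) = h Z X - h Z Y.
Proof. by apply/eqP; rewrite eq_sym subr_eq -tensor02Dr subrK. Qed.

Lemma flat_linear h f X Y : flat h (f *: X + Y) = f *: flat h X + flat h Y.
Proof. by apply: oneform_eq => Z; exact: tensor02ZDl. Qed.

Lemma flat0 h : flat h 0 = 0.
Proof. by apply: oneform_eq => Z; exact: tensor020l. Qed.

Lemma flatB h X Y : flat h (X - Y) = flat h X - flat h Y.
Proof. by rewrite addrC -scaleN1r flat_linear scaleN1r addrC. Qed.

Lemma codual_linear J f eta beta :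
  codual J (f *: eta + beta) = f *: codual J eta + codual J beta.
Proof. exact: oneform_eq. Qed.

Lemma codual_flat h J X : h_symmetric h J -> codual J (flat h X) = flat h (J X).
Proof. by move=> Js; apply: oneform_eq => Y; rewrite /= Js. Qed.

Section Sharp.
Variables (h : tensor02 M) (hinv : oneform M -> vfield M).
Hypotheses (hK : cancel (flat h) hinv) (hinvK : cancel hinv (flat h)).

Lemma sharp_linear f eta beta :
  hinv (f *: eta + beta) = f *: hinv eta + hinv beta.
Proof. by rewrite -{1}[eta]hinvK -{1}[beta]hinvK -flat_linear hK. Qed.

(** Pairing with an arbitrary [Z] turns identities of vector fields into identities of functions,
    where [ring] applies. *)
Lemma tensor02_inj X Y : (forall Z, h X Z = h Y Z) -> X = Y.
Proof. by move=> E; apply: (can_inj hK); apply: oneform_eq. Qed.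

Lemma Jhat_minus_linear J f s t :
  Jhat_minus h hinv J (f *: s + t) =
  f *: Jhat_minus h hinv J s + Jhat_minus h hinv J t.
Proof.
rewrite /Jhat_minus /=; congr pair.
  have JP X Y : J (f *: X + Y) = f *: J X + J Y by exact: linearP.
  rewrite sharp_linear !JP /= scalerBr scalerDr.
  by rewrite [X in _ - X]addrACA opprD addrACA.
by rewrite flat_linear codual_linear opprD addrACA -scalerBr.
Qed.

End Sharp.

End Forms.

(** * The difference tensor of the dual connections and its relation to [F_tensor] *)

Section StatisticalManifold.
Context {R : realType} {M : smoothManifold R}.
Variables (h : tensor02 M) (hinv : oneform M -> vfield M).
Variables (D Ds : connection M) (J : tensor11 M).
Hypotheses (h_sym : symmetric_tensor h).
Hypotheses (hK : cancel (flat h) hinv) (hinvK : cancel hinv (flat h)).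
Hypotheses (h_stat : statistical h D) (h_dual : dual_connection h D Ds).
Hypothesis (J_sym : h_symmetric h J).
Implicit Types (f : smoothfun M) (X Y Z A B : vfield M) (s t : gsection M).

Definition skewness X Y : vfield M := Ds X Y - D X Y.

Lemma tensor02_skewness X Y Z : h Y (skewness X Z) = cov_tensor02 D h X Y Z.
Proof. rewrite tensor02Br /cov_tensor02 h_dual; ring. Qed.

Lemma cov_tensor02_symm X Y Z : cov_tensor02 D h X Y Z = cov_tensor02 D h X Z Y.
Proof.
rewrite /cov_tensor02 (h_sym Y) (h_sym (D X Y)) (h_sym Y (D X Z)); ring.
Qed.

Lemma skewness_adjoint X Y Z : h Y (skewness X Z) = h (skewness X Y) Z.
Proof.
by rewrite (h_sym (skewness X Y)) !tensor02_skewness cov_tensor02_symm.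
Qed.

(** The Codazzi condition in [h_stat] enters here: it exchanges the first two slots of nabla h. *)
Lemma skewnessC X Y : skewness X Y = skewness Y X.
Proof.
apply: (tensor02_inj hK) => Z.
rewrite -skewness_adjoint tensor02_skewness (h_stat.2 X Y).
by rewrite -tensor02_skewness skewness_adjoint.
Qed.

Lemma skewnessDl X Y Z : skewness (X + Y) Z = skewness X Z + skewness Y Z.
Proof.
have connDl (D' : connection M) : D' (X + Y) Z = D' X Z + D' Y Z.
  by rewrite -[X in LHS]scale1r (conn_linearl D' Z) scale1r.
by rewrite /skewness !connDl opprD addrACA.
Qed.

Lemma skewnessBl X Y Z : skewness (X - Y) Z = skewness X Z - skewness Y Z.
Proof. by apply/eqP; rewrite eq_sym subr_eq -skewnessDl subrK. Qed.

Lemma skewnessBr X Y Z : skewness Z (X - Y) = skewness Z X - skewness Z Y.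
Proof. by rewrite !(skewnessC Z) skewnessBl. Qed.

Lemma skewness0r X : skewness X 0 = 0.
Proof. by rewrite -(subrr X) skewnessBr !subrr. Qed.

(** By [J_sym] the derivatives [X (h Y (J Z))] and [X (h (J Y) Z)] on the right cancel, leaving only
    connection terms. *)
Lemma F_tensor_skew X Y Z :
  F_tensor h D J X Y Z - F_tensor h D J X Z Y =
  cov_tensor02 D h X Y (J Z) - cov_tensor02 D h X (J Y) Z.
Proof.
rewrite /F_tensor /cov_tensor11 /cov_tensor02 !tensor02Bl !J_sym.
rewrite (h_sym (D X (J Z))) (h_sym (D X Z)) J_sym; ring.
Qed.

Lemma F_tensor_cyclic X Y Z :
  F_tensor h D J X Y Z + F_tensor h D J Y Z X
  - F_tensor h D J X Z Y - F_tensor h D J Y X Z =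
  h (skewness (J X) Y) Z - h (skewness X (J Y)) Z.
Proof.
(* Each pair has a fixed direction of differentiation, as [F_tensor_skew] requires. Of the four
   resulting terms in nabla h, the two containing [J Z] cancel by total symmetry. *)
transitivity ((F_tensor h D J X Y Z - F_tensor h D J X Z Y)
              + (F_tensor h D J Y Z X - F_tensor h D J Y X Z)); first by ring.
rewrite !F_tensor_skew (skewnessC (J X)) -!skewness_adjoint.
rewrite !tensor02_skewness (h_stat.2 X Y) (cov_tensor02_symm Y _ (J Z)).
rewrite (cov_tensor02_symm Y (J X)); ring.
Qed.

(** * Dependence of the bracket and the Nijenhuis tensor on alpha *)

(* -2 times the derivative of alpha |-> [s, t]_(nabla^(alpha)). *)
Definition skew_bracket s t : gsection M :=
  (0, flat h (skewness t.1 (hinv s.2) - skewness s.1 (hinv t.2))).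

(** Only the 1-form part sees the connection. There self-adjointness of [skewness X] rewrites the
    composite of a 1-form with it as a value of [flat h]. *)
Lemma bracket_alpha_conn (a : R) s t :
  bracket (alpha_conn D Ds a) s t =
  cst_fun ((1 - a) / 2) *: skew_bracket s t + bracket D s t.
Proof.
have alphaE X Y :
    alpha_conn D Ds a X Y = cst_fun ((1 - a) / 2) *: skewness X Y + D X Y.
  rewrite /= /alpha_conn_fun /skewness.
  have -> : (1 - a) / 2 = 1 - (1 + a) / 2 :> R by field.
  rewrite /cst_fun !scalerBl !scale1r scalerBr opprB.
  by rewrite [RHS]addrAC subrK addrCA.
have sharpE (eta : oneform M) X Z :
    eta (skewness X Z) = h (skewness X (hinv eta)) Z.
  by rewrite -skewness_adjoint -[eta in LHS]hinvK.
rewrite /bracket /skew_bracket; congr pair => /=.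
  by rewrite scaler0 add0r.
case: s t => [X eta] [Y beta]; apply: oneform_eq => Z /=.
change (X (beta Z) - beta (alpha_conn D Ds a X Z)
        - (Y (eta Z) - eta (alpha_conn D Ds a Y Z)) =
  cst_fun ((1 - a) / 2) * h (skewness Y (hinv eta) - skewness X (hinv beta)) Z
  + (X (beta Z) - beta (D X Z) - (Y (eta Z) - eta (D Y Z)))).
rewrite !alphaE !oneformZD !sharpE tensor02Bl; ring.
Qed.

Local Notation Jh := (Jhat_minus h hinv J).

Definition skew_nijenhuis s t : gsection M :=
  skew_bracket (Jh s) (Jh t) - Jh (skew_bracket (Jh s) t)
  - Jh (skew_bracket s (Jh t)) + Jh (Jh (skew_bracket s t)).

(** Since [Jh] is linear, the Nijenhuis expression is linear in the bracket and inherits its affine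
    dependence on alpha. *)
Lemma nijenhuis_alpha_conn (a : R) s t :
  nijenhuis (alpha_conn D Ds a) Jh s t =
  cst_fun ((1 - a) / 2) *: skew_nijenhuis s t + nijenhuis D Jh s t.
Proof.
have regroup (V : zmodType) (p q r e p' q' r' e' : V) :
    (p + p') - (q + q') - (r + r') + (e + e')
    = (p - q - r + e) + (p' - q' - r' + e').
  by rewrite !opprD (addrACA p) (addrACA (p - q)) (addrACA (p - q - r)).
rewrite /nijenhuis /skew_nijenhuis !bracket_alpha_conn.
rewrite !(Jhat_minus_linear hK hinvK) scalerDr !scalerBr.
exact: regroup.
Qed.

(** * Explicit form of the difference, with 1-forms written as [flat h A] *)

Lemma Jhat_minus_flat X A :
  Jh (X, flat h A) = (J X - (A + J (J A)), flat h (X - J A)).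
Proof. by rewrite /Jhat_minus /= hK codual_flat // flatB. Qed.

Lemma skew_bracket_flat X A Y B :
  skew_bracket (X, flat h A) (Y, flat h B) =
  (0, flat h (skewness Y A - skewness X B)).
Proof. by rewrite /skew_bracket /= !hK. Qed.

(** This reduces the last term of [skew_nijenhuis] to minus a bracket. *)
Lemma Jhat_minus_sq s : Jh (Jh s) = - s.
Proof.
case: s => X eta; rewrite -[eta]hinvK; set A := hinv eta.
have JB Y Z : J (Y - Z) = J Y - J Z by exact: linearB.
have JD Y Z : J (Y + Z) = J Y + J Z by exact: linearD.
rewrite !Jhat_minus_flat.
transitivity (- X, flat h (- A)); last first.
  by rewrite -[- A]add0r flatB flat0 sub0r.
congr (_, flat h _); apply: (tensor02_inj hK) => Z;
  by rewrite !(JB, JD, tensor02Bl, tensor02Dl, tensor02Nl); ring.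
Qed.

(** [X'] and [Y'] are the vector parts of the images under [Jh]. The two mixed brackets are pure
    1-forms, and [W] corresponds to their sum under [flat h]. *)
Lemma skew_nijenhuis_flat X A Y B :
  let X' := J X - (A + J (J A)) in let Y' := J Y - (B + J (J B)) in
  let W := (skewness Y (X - J A) - skewness X' B)
           + (skewness Y' A - skewness X (Y - J B)) in
  skew_nijenhuis (X, flat h A) (Y, flat h B) =
  (W + J (J W),
   flat h (skewness Y' (X - J A) - skewness X' (Y - J B) + J W
           - (skewness Y A - skewness X B))).
Proof.
move=> X' Y' W.
have J0 : J 0 = 0 by exact: linear0.
have JD V V' : J (V + V') = J V + J V' by exact: linearD.
rewrite /skew_nijenhuis Jhat_minus_sq.
rewrite (Jhat_minus_flat X) (Jhat_minus_flat Y) -/X' -/Y'.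
rewrite !skew_bracket_flat !Jhat_minus_flat J0 !sub0r /W.
set U := skewness Y (X - _) - _; set V := _ - skewness X (Y - _).
transitivity (0 - - (U + J (J U)) - - (V + J (J V)) + - 0,
  flat h (skewness Y' (X - J A) - skewness X' (Y - J B)) - flat h (- J U)
  - flat h (- J V) - flat h (skewness Y A - skewness X B)); first by [].
rewrite -!flatB !opprK add0r oppr0 addr0 (JD U) (JD (J U)); congr (_, flat h _).
  by rewrite addrACA.
by rewrite addrA.
Qed.

End StatisticalManifold.

Theorem proposition4p11 (R : realType) (M : smoothManifold R)
  (h : tensor02 M) (hinv : oneform M -> vfield M)
  (nabla nablaS : connection M) (J : tensor11 M)
  (h_sym : symmetric_tensor h)
  (h_nondeg : nondegenerate_tensor h)
  (hK : cancel (flat h) hinv) (hinvK : cancel hinv (flat h))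
  (nabla_tf : torsion_free nabla)
  (h_stat : statistical h nabla)
  (h_dual : dual_connection h nabla nablaS)
  (J_sym : h_symmetric h J) :
  (forall (X Y : vfield M) (eta beta : oneform M) (alpha : R),
     nijenhuis (alpha_conn nabla nablaS alpha) (Jhat_minus h hinv J)
       (X, eta) (Y, beta) =
     nijenhuis nabla (Jhat_minus h hinv J) (X, eta) (Y, beta))
  <->
  (forall X Y Z : vfield M,
     F_tensor h nabla J X Y Z + F_tensor h nabla J Y Z X
     - F_tensor h nabla J X Z Y - F_tensor h nabla J Y X Z = 0).
Proof.
have cyc := F_tensor_cyclic h_sym hK h_stat h_dual J_sym.
have nijE := nijenhuis_alpha_conn J h_sym hK hinvK h_dual.
have snE := skew_nijenhuis_flat nabla nablaS hK hinvK J_sym.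
have KC := skewnessC h_sym hK h_stat h_dual.
have KDl := skewnessDl nabla nablaS.
have KBl := skewnessBl nabla nablaS.
have KBr := skewnessBr h_sym hK h_stat h_dual.
have K0 := skewness0r h_sym hK h_stat h_dual.
have J0 : J 0 = 0 by exact: linear0.
set K := skewness nabla nablaS in cyc snE KC KDl KBl KBr K0.
split=> [N X Y Z | F0].
  (* The value alpha = -1 makes the factor (1 - alpha)/2 equal to 1. Zero forms are written
     [flat h 0] so that [snE] applies; then [W] vanishes by symmetry of [K]. *)
  have c1 : cst_fun ((1 - (-1)) / 2) = 1 :> smoothfun M.
    by rewrite /cst_fun opprK divff ?scale1r.
  have := N X Y (flat h 0) (flat h 0) (-1); rewrite nijE c1 scale1r.
  rewrite -[RHS]add0r => /addIr; rewrite snE.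
  rewrite !(J0, addr0, subr0, K0) sub0r (KC Y X) subrr J0 !addr0.
  move=> /(congr1 (fun s : gsection M => s.2 Z)).
  rewrite /= tensor02Bl cyc (KC X) => E.
  by rewrite -opprB E; exact: oppr0.
have cm X Y : K (J X) Y = K X (J Y).
  by apply: (tensor02_inj hK) => Z; apply/eqP; rewrite -subr_eq0 -cyc F0.
(* Moving [J] across the symmetric [K] makes [K X] of a power of [J] at [Y] symmetric in [X] and
   [Y]. Powers up to 3 suffice: [X'], [Y'] have degree 2 in [J], the other arguments degree 1. *)
have KJ X Y : K X (J Y) = K Y (J X) by rewrite KC cm.
have KJ2 X Y : K X (J (J Y)) = K Y (J (J X)) by rewrite KJ cm.
have KJ3 X Y : K X (J (J (J Y))) = K Y (J (J (J X))) by rewrite KJ 2!cm.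
have sn0 X A Y B : skew_nijenhuis h hinv nabla nablaS J
    (X, flat h A) (Y, flat h B) = 0.
  rewrite snE; set X' := J X - _; set Y' := J Y - _.
  have -> : K Y (X - J A) - K X' B + (K Y' A - K X (Y - J B)) = 0.
    (* Normal form: all powers of [J] go to the second slot and each pair of fields gets a fixed
       order. *)
    rewrite !(KBl, KDl, KBr) !cm (KC B A) (KC Y X) (KJ Y A) (KJ2 B A).
    apply: (tensor02_inj hK) => Z.
    by rewrite !(tensor02Bl, tensor02Dl) tensor020l; ring.
  rewrite !J0 !addr0.
  have -> : K Y' (X - J A) - K X' (Y - J B) = K Y A - K X B.
    rewrite !(KBl, KDl, KBr) !cm.
    rewrite (KJ Y X) (KJ2 Y A) (KJ B A) (KJ2 B X) (KJ3 B A) (KC B) (KC Y A).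
    by apply: (tensor02_inj hK) => Z; rewrite !(tensor02Bl, tensor02Dl); ring.
  by rewrite subrr flat0.
move=> X Y eta beta a.
by rewrite -[eta]hinvK -[beta]hinvK nijE sn0 scaler0 add0r.
Qed.
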